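(* Let $R\hookrightarrow S$ be a pure finite local homomorphism of local domains of characteristic $p>0$, let $\mathfrak a$ be a nonzero ideal of $R$, and let $t\ge0$ be a real number. If $(S,(\mathfrak aS)^t)$ is $F$-rational, then so is $(R,\mathfrak a^t)$.
   Context: All rings are excellent, noetherian, commutative, with identity. For a reduced ring $R$ of characteristic $p>0$, $R^\circ$ is the set of elements not in any minimal prime (so $R^\circ=R\setminus\{0\}$ for a domain), and $I^{[q]}$ is the ideal generated by $q$-th powers of elements of $I$ for $q=p^e$. For an ideal $\mathfrak a$ with $\mathfrak a\cap R^\circ\ne\emptyset$ and real $t\ge0$, $I^{*\mathfrak a^t}$ is the set of $z\in R$ for which there is $c\in R^\circ$ with $c\,\mathfrak a^{\lceil tq\rceil}z^q\subseteq I^{[q]}$ for all large $q=p^e$. For $R$ local, $(R,\mathfrak a^t)$ is $F$-rational if $I^{*\mathfrak a^t}=I$ for every ideal $I$ generated by a system of parameters for $R$. *)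

(* Defs.v *)
From HB Require Import structures.
From mathcomp Require Import all_boot all_order all_algebra.
From mathcomp Require Import boolp classical_sets reals.
Set Implicit Arguments.
Unset Strict Implicit.
Unset Printing Implicit Defensive.
Import Order.TTheory GRing.Theory Num.Theory.
Local Open Scope classical_set_scope.
Local Open Scope ring_scope.

(* Ideals are Prop-valued subsets and need not be proper; the zero ring is
   allowed, since it occurs among tensor products and finite type algebras. *)

Section Ideals.
Variable R : comPzRingType.
Implicit Types (I J P M : set R).

Definition is_ideal I : Prop :=
  [/\ I 0, (forall x y, I x -> I y -> I (x + y))
    & (forall a x, I x -> I (a * x))].

Definition ideal_gen (A : set R) : set R := smallest is_ideal A.

(* For n = 0 the only product is the empty one, so I^0 is the unit ideal. *)
Definition ideal_pow I (n : nat) : set R :=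
  ideal_gen [set x | exists u : 'I_n -> R,
                       (forall i, I (u i)) /\ x = \prod_(i < n) u i].

Definition frobenius_pow I (q : nat) : set R :=
  ideal_gen [set x ^+ q | x in I].

Definition radical I : set R := [set x | exists n : nat, I (x ^+ n)].

Definition is_prime P : Prop :=
  [/\ is_ideal P, ~ P 1 & forall x y, P (x * y) -> P x \/ P y].

Definition is_maximal M : Prop :=
  [/\ is_ideal M, ~ M 1
    & forall J, is_ideal J -> M `<=` J -> J = M \/ J 1].

Definition is_minimal_prime P : Prop :=
  is_prime P /\ forall Q : set R, is_prime Q -> Q `<=` P -> Q = P.

Definition noetherian : Prop :=
  forall I, is_ideal I -> exists n (x : 'I_n -> R), I = ideal_gen (range x).

Definition is_local : Prop := exists! M, is_maximal M.

(* P 0 < P 1 < ... < P n; the values P i for i > n are irrelevant. *)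
Definition is_prime_chain (n : nat) (P : nat -> set R) : Prop :=
  (forall i, (i <= n)%N -> is_prime (P i)) /\
  (forall i, (i < n)%N -> P i `<` P i.+1).

Definition krull_dim (d : nat) : Prop :=
  (exists P : nat -> set R, is_prime_chain d P) /\
  (forall n (P : nat -> set R), is_prime_chain n P -> (n <= d)%N).

(* x_1, ..., x_d generate an ideal primary to the maximal ideal, d = dim R *)
Definition is_sop (d : nat) (x : 'I_d -> R) : Prop :=
  krull_dim d /\ exists M, is_maximal M /\ radical (ideal_gen (range x)) = M.

End Ideals.

Arguments noetherian : clear implicits.
Arguments is_local : clear implicits.
Arguments krull_dim : clear implicits.

Section Homomorphisms.
Variables (R S : comPzRingType) (f : {rmorphism R -> S}).

Definition ideal_ext (I : set R) : set S := ideal_gen (f @` I).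

Definition is_local_hom : Prop :=
  forall (m : set R) (n : set S),
    is_maximal m -> is_maximal n -> f @` m `<=` n.

Definition is_finite_hom : Prop :=
  exists n (b : 'I_n -> S),
    forall y, exists r : 'I_n -> R, y = \sum_(i < n) f (r i) * b i.

Definition is_finite_type_hom : Prop :=
  exists n (b : 'I_n -> S), forall A : set S,
    (forall r, A (f r)) -> (forall i, A (b i)) ->
    (forall x y, A x -> A y -> A (x + y)) ->
    (forall x y, A x -> A y -> A (x * y)) ->
    forall y, A y.

(* R-bilinear maps M x S -> N, where R acts on S through f *)
Definition is_bilinear (M N : lmodType R) (b : M -> S -> N) : Prop :=
  [/\ (forall m m' s, b (m + m') s = b m s + b m' s),
      (forall m s s', b m (s + s') = b m s + b m s'),
      (forall r m s, b (r *: m) s = r *: b m s)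
    & (forall r m s, b m (f r * s) = r *: b m s)].

(* (T, tau) is the tensor product of M and S over R *)
Definition is_tensor_product (M T : lmodType R) (tau : M -> S -> T) : Prop :=
  is_bilinear tau /\
  forall (N : lmodType R) (b : M -> S -> N), is_bilinear b ->
    exists g : {linear T -> N},
      (forall m s, g (tau m s) = b m s) /\
      (forall g' : {linear T -> N},
         (forall m s, g' (tau m s) = b m s) -> g' =1 g).

Definition is_pure : Prop :=
  forall (M T : lmodType R) (tau : M -> S -> T),
    is_tensor_product tau -> injective (fun m : M => tau m 1).

(* f exhibits S as the localization of R at the prime ideal P *)
Definition is_localization (P : set R) : Prop :=
  [/\ (forall s, ~ P s -> exists u, f s * u = 1),
      (forall y, exists r s, ~ P s /\ y * f s = f r)
    & (forall r, f r = 0 -> exists s, ~ P s /\ s * r = 0)].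

(* f exhibits S as the m-adic completion of R, for R noetherian: R/m^n -> S/m^nS
   is bijective for all n, and S is separated and complete for the mS-adic
   topology *)
Definition is_completion (m : set R) : Prop :=
  [/\ (forall n r, ideal_ext (ideal_pow m n) (f r) -> ideal_pow m n r),
      (forall n y, exists r, ideal_ext (ideal_pow m n) (y - f r)),
      (forall y, (forall n, ideal_ext (ideal_pow m n) y) -> y = 0)
    & (forall u : nat -> S,
         (forall n, ideal_ext (ideal_pow m n) (u n.+1 - u n)) ->
         exists l, forall n, ideal_ext (ideal_pow m n) (l - u n))].

End Homomorphisms.

(* T = B (x)_A C as rings *)
Definition is_pushout (A B C T : comPzRingType)
    (f : {rmorphism A -> B}) (g : {rmorphism A -> C})
    (i : {rmorphism B -> T}) (j : {rmorphism C -> T}) : Prop :=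
  (forall a, i (f a) = j (g a)) /\
  forall (T' : comPzRingType)
    (i' : {rmorphism B -> T'}) (j' : {rmorphism C -> T'}),
    (forall a, i' (f a) = j' (g a)) ->
    exists u : {rmorphism T -> T'},
      [/\ (forall x, u (i x) = i' x), (forall y, u (j y) = j' y)
        & (forall v : {rmorphism T -> T'},
             (forall x, v (i x) = i' x) -> (forall y, v (j y) = j' y) ->
             v =1 u)].

(* k is the residue field of the prime P of R *)
Definition is_residue_field (R : comPzRingType) (k : fieldType)
    (g : {rmorphism R -> k}) (P : set R) : Prop :=
  (forall r, g r = 0 <-> P r) /\
  (forall y, exists r s, g s != 0 /\ y = g r / g s).

Definition regular_local (R : comPzRingType) : Prop :=
  [/\ noetherian R, is_local R
    & exists d (x : 'I_d -> R),
        krull_dim R d /\ is_maximal (ideal_gen (range x))].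

Definition regular_at (R : comPzRingType) (P : set R) : Prop :=
  forall (A : comPzRingType) (g : {rmorphism R -> A}),
    is_localization g P -> regular_local A.

Definition regular (R : comPzRingType) : Prop :=
  noetherian R /\ forall P : set R, is_prime P -> regular_at P.

Definition geometrically_regular (k : fieldType) (B : comPzRingType)
    (h : {rmorphism k -> B}) : Prop :=
  forall (L : fieldType) (e : {rmorphism k -> L}), is_finite_hom e ->
  forall (T : comPzRingType) (i : {rmorphism B -> T}) (j : {rmorphism L -> T}),
    is_pushout h e i j -> regular T.

(* for every prime P of R, the formal fibres of R_P are geometrically regular *)
Definition G_ring (R : comPzRingType) : Prop :=
  forall P : set R, is_prime P ->
  forall (A : comPzRingType) (g : {rmorphism R -> A}), is_localization g P ->
  forall m : set A, is_maximal m ->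
  forall (Ah : comPzRingType) (c : {rmorphism A -> Ah}), is_completion c m ->
  forall Q : set A, is_prime Q ->
  forall (k : fieldType) (h : {rmorphism A -> k}), is_residue_field h Q ->
  forall (F : comPzRingType) (i : {rmorphism Ah -> F}) (j : {rmorphism k -> F}),
    is_pushout c h i j -> geometrically_regular j.

Definition is_saturated (R : comPzRingType) (n : nat) (P : nat -> set R) : Prop :=
  forall i, (i < n)%N ->
    ~ exists Q : set R, [/\ is_prime Q, P i `<` Q & Q `<` P i.+1].

Definition catenary (R : comPzRingType) : Prop :=
  forall p q : set R, is_prime p -> is_prime q -> p `<=` q ->
  exists l : nat, forall n (P : nat -> set R),
    is_prime_chain n P -> P 0%N = p -> P n = q ->
    (n <= l)%N /\ (is_saturated n P -> n = l).

Definition universally_catenary (R : comPzRingType) : Prop :=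
  forall (B : comPzRingType) (f : {rmorphism R -> B}),
    is_finite_type_hom f -> catenary B.

(* the regular locus of every R-algebra of finite type is Zariski open *)
Definition J2 (R : comPzRingType) : Prop :=
  forall (B : comPzRingType) (f : {rmorphism R -> B}), is_finite_type_hom f ->
  exists I : set B, is_ideal I /\
    forall P : set B, is_prime P -> (regular_at P <-> ~ (I `<=` P)).

Definition excellent (R : comPzRingType) : Prop :=
  [/\ noetherian R, universally_catenary R, G_ring R & J2 R].

Section TightClosure.
Variables (p : nat) (R : comPzRingType) (K : realType).
Implicit Types (I a : set R) (t : K).

(* R minus the union of its minimal primes *)
Definition ring_circ : set R :=
  [set c | forall P : set R, is_minimal_prime P -> ~ P c].

(* The absolute value only casts the ceiling to nat: it is used for t >= 0. *)
Definition tight_closure I a t : set R :=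
  [set z | exists c, ring_circ c /\
     exists e0 : nat, forall e : nat, (e0 <= e)%N ->
       forall x, ideal_pow a `|Num.ceil (t * (p ^ e)%:R)|%N x ->
         frobenius_pow I (p ^ e) (c * x * z ^+ (p ^ e))].

(* for R local of characteristic p *)
Definition F_rational a t : Prop :=
  forall d (x : 'I_d -> R), is_sop x ->
    tight_closure (ideal_gen (range x)) a t = ideal_gen (range x).

End TightClosure.

(* Main.v *)
(* Write I for the ideal of a system of parameters of R. Lying over, going up
   and incomparability for the finite injection f give dim S = dim R and show
   that the maximal ideal of S is the only prime containing IS, so IS is again
   generated by a system of parameters. A multiplier c for z in R maps to the
   nonzero multiplier f c for f z, so f z lies in the tight closure of IS, which
   is IS. Purity applied to R/I, whose tensor product with S is S/IS, says that
   IS contracts to I. *)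
Require Import Defs.
From HB Require Import structures.
From mathcomp Require Import all_boot all_order all_algebra.
From mathcomp Require Import boolp classical_sets reals.
Set Implicit Arguments.
Unset Strict Implicit.
Unset Printing Implicit Defensive.
Import Order.TTheory GRing.Theory Num.Theory.
Local Open Scope classical_set_scope.
Local Open Scope ring_scope.

(** * Ideals, prime avoidance and maximal ideals *)

Section IdealFacts.
Variable R : comPzRingType.
Implicit Types (I J P M W : set R).

Lemma idealN I x : is_ideal I -> I x -> I (- x).
Proof. by case=> _ _ IM Ix; rewrite -mulN1r; apply: IM. Qed.

Lemma idealB I x y : is_ideal I -> I x -> I y -> I (x - y).
Proof. by move=> Iid Ix Iy; case: (Iid) => _ ID _; apply: ID => //; apply: idealN. Qed.

Lemma ideal_sum I (T : finType) (F : T -> R) :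
  is_ideal I -> (forall i, I (F i)) -> I (\sum_i F i).
Proof. by case=> I0 ID _ IF; elim/big_ind: _. Qed.

Lemma ideal_gen_ideal (A : set R) : is_ideal (ideal_gen A).
Proof.
split=> [I [[]] //|x y Ax Ay I IA|a x Ax I IA].
- by case: (IA) => [[_ ID _] _]; apply: ID; [apply: Ax|apply: Ay].
- by case: (IA) => [[_ _ IM] _]; apply: IM; apply: Ax.
Qed.

Lemma sub_ideal_gen (A : set R) : A `<=` ideal_gen A.
Proof. exact: sub_gen_smallest. Qed.

Lemma ideal_gen_sub (A I : set R) :
  is_ideal I -> A `<=` I -> ideal_gen A `<=` I.
Proof. exact: smallest_sub. Qed.

Lemma prime_expr P x n : is_prime P -> P (x ^+ n) -> P x.
Proof.
case=> _ P1 PM; elim: n => [/P1 //|n IHn]; rewrite exprS.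
by case/PM.
Qed.

Lemma radical_sub_prime I P : is_prime P -> I `<=` P -> radical I `<=` P.
Proof. by move=> Pp IP x [n /IP]; apply: prime_expr. Qed.

Lemma ideal_add I J :
  is_ideal I -> is_ideal J ->
  is_ideal [set x | exists y z, [/\ I y, J z & x = y + z]].
Proof.
move=> [I0 ID IM] [J0 JD JM]; split.
- by exists 0, 0; rewrite addr0.
- move=> _ _ [y [z [Iy Jz ->]]] [y' [z' [Iy' Jz' ->]]].
  by exists (y + y'), (z + z'); split; [apply: ID|apply: JD|rewrite addrACA].
- move=> a _ [y [z [Iy Jz ->]]]; exists (a * y), (a * z).
  by split; [apply: IM|apply: JM|rewrite mulrDr].
Qed.

(** Zorn's lemma: a union of a nonempty chain of ideals avoiding [W] is again such an ideal. [W] is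
    an arbitrary subset; [[set 1]] yields maximal ideals, multiplicative sets yield primes. *)
Lemma exists_maximal_avoiding J W :
  is_ideal J -> (forall x, J x -> ~ W x) ->
  exists Q, [/\ is_ideal Q, J `<=` Q, (forall x, Q x -> ~ W x)
    & forall Q', is_ideal Q' -> Q `<=` Q' -> (forall x, Q' x -> ~ W x) ->
        Q' = Q].
Proof.
move=> Jid JW.
pose good Q := [/\ is_ideal Q, J `<=` Q & forall x, Q x -> ~ W x].
have [F Fgood Ftot|A [A0good Amax]] :=
  @Zorn_bigcup _ [set Q | Q = set0 \/ good Q].
  have [[Q [FQ Qgood]]|noQ] := pselect (exists Q, F Q /\ good Q); last first.
    left; apply/seteqP; split=> // x [Q FQ Qx].
    have [Q0|Qg] := Fgood Q FQ; first by rewrite Q0 in Qx.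
    by case: noQ; exists Q.
  have goodF X x : F X -> X x -> good X.
    by move=> FX Xx; case: (Fgood X FX) => // X0; rewrite X0 in Xx.
  have [[Q0 _ _] JQ _] := Qgood.
  right; split; first split.
  - by exists Q.
  - move=> x y [X FX Xx] [Y FY Yy].
    have [[_ XD _] _ _] := goodF X x FX Xx.
    have [[_ YD _] _ _] := goodF Y y FY Yy.
    have [XY|YX] := Ftot X Y FX FY.
      by exists Y => //; apply: YD => //; apply: XY.
    by exists X => //; apply: XD => //; apply: YX.
  - move=> a x [X FX Xx]; exists X => //.
    by have [[_ _ XM] _ _] := goodF X x FX Xx; apply: XM.
  - by move=> x /JQ Qx; exists Q.
  - by move=> x [X FX Xx]; have [_ _ XW] := goodF X x FX Xx; apply: XW.
have Agood : good A.
  case: A0good => // A0; exfalso; apply: (Amax J); last by right; split.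
  by split; rewrite A0 // => J0; apply: (J0 0); case: Jid.
have [Aid JA AW] := Agood.
exists A; split=> // Q' Q'id AQ' Q'W; apply/seteqP; split=> //.
apply: contrapT => nQ'A; apply: (Amax Q'); first by split.
by right; split=> //; apply: subset_trans AQ'.
Qed.

(** An ideal [Q] maximal among those disjoint from a multiplicative set is prime: if [x] and [y] lie
    outside [Q], both [Q + (x)] and [Q + (y)] meet [W], and the product of the two meeting points
    lies in [W] and in [Q + (x * y)], so [x * y] is not in [Q]. *)
Lemma exists_prime_avoiding J W :
  is_ideal J -> W 1 -> (forall x y, W x -> W y -> W (x * y)) ->
  (forall x, J x -> ~ W x) ->
  exists Q, [/\ is_prime Q, J `<=` Q & forall x, Q x -> ~ W x].
Proof.
move=> Jid W1 WM JW; have [Q [Qid JQ QW Qmax]] := exists_maximal_avoiding Jid JW.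
exists Q; split=> //; split=> //; first by move=> /QW.
have meets x : ~ Q x -> exists a b, Q b /\ W (a * x + b).
  move=> nQx; apply: contrapT => no; apply: nQx.
  have idx : is_ideal [set z | exists a, z = a * x].
    split=> [|_ _ [a ->] [b ->]|c _ [a ->]].
    - by exists 0; rewrite mul0r.
    - by exists (a + b); rewrite mulrDl.
    - by exists (c * a); rewrite mulrA.
  rewrite -(Qmax _ (ideal_add idx Qid)).
  - exists x, 0; split; [|by case: Qid|by rewrite addr0].
    by exists 1; rewrite mul1r.
  - move=> z Qz; exists 0, z; split=> //; last by rewrite add0r.
    by exists 0; rewrite mul0r.
  - move=> _ [_ [z [[a ->] Qz ->]]] Wz.
    by apply: no; exists a, z.
move=> x y Qxy; apply: contrapT => /not_orP[/meets[a [b [Qb Wx]]]].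
move=> /meets[c [d [Qd Wy]]]; apply: QW (WM _ _ Wx Wy).
have [_ QD QM] := Qid.
have -> : (a * x + b) * (c * y + d)
    = (a * c) * (x * y) + ((c * y + d) * b + (a * x) * d).
  rewrite [in LHS]mulrDl mulrDr mulrACA -addrA; congr (_ + _).
  by rewrite addrC [b * _]mulrC.
by apply: (QD); [apply: QM|apply: (QD); apply: (QM)].
Qed.

Lemma maximal_prime M : is_maximal M -> is_prime M.
Proof.
case=> Mid M1 Mmax.
have [||x Mx xE|Q [Qp MQ _]] := exists_prime_avoiding (W := [set 1]) Mid.
- by [].
- by move=> x y -> ->; rewrite mulr1.
- by apply: M1; rewrite -xE.
have [Qid Q1 _] := Qp.
by case: (Mmax _ Qid MQ) => // QM; rewrite -QM.
Qed.

Lemma local_maximal_unique M M' :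
  is_local R -> is_maximal M -> is_maximal M' -> M = M'.
Proof. by move=> [N [_ NU]] /NU <- /NU <-. Qed.

(** An ideal containing [Q] and maximal among those avoiding 1 is a maximal ideal, hence equal to
    [M] by locality. *)
Lemma local_ideal_sub M Q :
  is_local R -> is_maximal M -> is_ideal Q -> ~ Q 1 -> Q `<=` M.
Proof.
move=> Rloc Mmax Qid Q1.
have [x Qx xE|N [Nid QN N1 Nmax]] :=
    @exists_maximal_avoiding Q [set 1] Qid; first by apply: Q1; rewrite -xE.
rewrite (local_maximal_unique Rloc Mmax (M' := N)) //.
split=> // [/N1/(_ erefl) //|J Jid NJ].
have [J1|J1] := pselect (J 1); [by right|left].
by apply: Nmax => // x Jx xE; apply: J1; rewrite -xE.
Qed.

(** Congruence modulo [J] passes through the products and the sum of the Leibniz formula. *)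
Lemma det_cong_ideal n (A B : 'M[R]_n) J :
  is_ideal J -> (forall i j, J (A i j - B i j)) -> J (\det A - \det B).
Proof.
move=> Jid AB; have [J0 JD JM] := Jid.
rewrite /determinant -sumrB; apply: ideal_sum => // s.
rewrite -mulrBr; apply: (JM).
apply: (big_ind2 (fun x y => J (x - y))) => [|x1 x2 y1 y2 J1 J2|i _].
- by rewrite subrr.
- have -> : x1 * y1 - x2 * y2 = y1 * (x1 - x2) + x2 * (y1 - y2).
    by rewrite !mulrBr [y1 * x1]mulrC [y1 * x2]mulrC addrA subrK.
  by apply: JD; apply: JM.
- exact: AB.
Qed.

End IdealFacts.

(** * Contraction and extension of ideals *)

Section Contraction.
Variables (R S : comPzRingType) (f : {rmorphism R -> S}).

Lemma ideal_preim (J : set S) : is_ideal J -> is_ideal (f @^-1` J).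
Proof.
case=> J0 JD JM; split=> [|x y Jx Jy|a x Jx]; rewrite /preimage /=.
- by rewrite rmorph0.
- by rewrite rmorphD; apply: JD.
- by rewrite rmorphM; apply: JM.
Qed.

Lemma prime_preim (Q : set S) : is_prime Q -> is_prime (f @^-1` Q).
Proof.
case=> Qid Q1 QM; split; first exact: ideal_preim.
  by rewrite /preimage /= rmorph1.
by move=> x y; rewrite /preimage /= rmorphM => /QM.
Qed.

Lemma sub_ideal_ext (I : set R) x : I x -> ideal_ext f I (f x).
Proof. by move=> Ix; apply: sub_ideal_gen; exists x. Qed.

Lemma ideal_ext_sub (I : set R) (J : set S) :
  is_ideal J -> (forall x, I x -> J (f x)) -> ideal_ext f I `<=` J.
Proof. by move=> Jid IJ; apply: ideal_gen_sub => // _ [x /IJ Jx <-]. Qed.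

Lemma ideal_ext_gen (T : Type) (x : T -> R) :
  ideal_ext f (ideal_gen (range x)) = ideal_gen (range (f \o x)).
Proof.
apply/seteqP; split.
  apply: ideal_ext_sub; first exact: ideal_gen_ideal.
  apply: (ideal_gen_sub (ideal_preim (ideal_gen_ideal _))) => _ [i _ <-].
  by apply: sub_ideal_gen; exists i.
apply: ideal_gen_sub; first exact: ideal_gen_ideal.
by move=> _ [i _ <-] /=; apply: sub_ideal_ext; apply: sub_ideal_gen; exists i.
Qed.

End Contraction.

(** * Going up for finite homomorphisms *)

Section FiniteExtension.
Variables (R S : comPzRingType) (f : {rmorphism R -> S}).
Hypothesis f_fin : is_finite_hom f.

(* Determinant trick. *)
Lemma finite_hom_det (P : set R) (y : S) :
  is_ideal P -> ideal_ext f P y ->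
  exists n (A : 'M[R]_n), (forall i j, P (A i j)) /\
    \det (y%:M - map_mx f A) = 0.
Proof.
move=> Pid Py; have [P0 PD PM] := Pid; have [n [b bgen]] := f_fin.
pose comb := [set z | exists r : 'I_n -> R, (forall i, P (r i)) /\
                        z = \sum_(i < n) f (r i) * b i].
(* Combinations of the [b i] with coefficients in [P] form an ideal of [S] containing the image of
   [P], because each [s * b i] is again an [R]-combination of the generators. *)
have combP : ideal_ext f P `<=` comb.
  apply: ideal_ext_sub; first split.
  - exists (fun=> 0); split=> //; rewrite big1 // => i _.
    by rewrite rmorph0 mul0r.
  - move=> _ _ [r [Pr ->]] [r' [Pr' ->]]; exists (fun i => r i + r' i).
    split=> [i|]; first exact: PD.
    by rewrite -big_split; apply: eq_bigr => i _; rewrite rmorphD mulrDl.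
  - move=> s _ [r [Pr ->]].
    have /choice[c cE] : forall i, exists c : 'I_n -> R,
        s * b i = \sum_(j < n) f (c j) * b j by move=> i; apply: bgen.
    exists (fun j => \sum_i c i j * r i); split=> [j|].
      by apply: ideal_sum => // i; apply: PM.
    rewrite mulr_sumr; under eq_bigr => i _ do
      rewrite mulrCA cE mulr_sumr.
    rewrite exchange_big; apply: eq_bigr => j _.
    rewrite rmorph_sum mulr_suml; apply: eq_bigr => i _.
    by rewrite rmorphM mulrA [f (r i) * _]mulrC.
  - move=> x Px; have [e eE] := bgen 1.
    exists (fun i => e i * x); split=> [i|]; first exact: PM.
    rewrite -[f x]mulr1 eE mulr_sumr; apply: eq_bigr => i _.
    by rewrite rmorphM mulrA [f x * _]mulrC.
have /choice[A AE] : forall i, exists r : 'I_n -> R,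
    (forall j, P (r j)) /\ y * b i = \sum_(j < n) f (r j) * b j.
  move=> i; apply: combP; rewrite mulrC.
  by case: (ideal_gen_ideal (f @` P)) => _ _; apply.
pose B : 'M[R]_n := \matrix_(i, j) A i j.
exists n, B; split=> [i j|]; first by rewrite mxE; case: (AE i).
pose C : 'M[S]_n := y%:M - map_mx f B.
have Cb : C *m (\col_i b i) = 0.
  apply/matrixP => i k; rewrite !mxE.
  under eq_bigr => j _ do rewrite !mxE mulrBl.
  rewrite sumrB (bigD1 i) //= eqxx mulr1n big1 ?addr0; last first.
    by move=> j ji; rewrite eq_sym (negPf ji) mulr0n mul0r.
  by case: (AE i) => _ ->; rewrite subrr.
(* Multiplying by the adjugate shows that [\det C] kills every generator, hence also 1, which is a
   combination of them. *)
have detb i : \det C * b i = 0.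
  have : (\adj C *m (C *m (\col_i b i))) i 0 = 0 by rewrite Cb mulmx0 mxE.
  by rewrite mulmxA mul_adj_mx mul_scalar_mx !mxE.
have [e eE] := bgen 1.
rewrite -[\det _]mulr1 eE mulr_sumr big1 // => i _.
by rewrite mulrCA detb mulr0.
Qed.

(** [Q'] is a prime containing [Q + P'S] and avoiding the image of the complement of [P']: the first
    condition gives one inclusion of the contraction in [P'], the second the other. *)
Lemma going_up (P' : set R) (Q : set S) :
  is_prime P' -> is_prime Q -> f @^-1` Q `<=` P' ->
  exists Q', [/\ is_prime Q', Q `<=` Q' & f @^-1` Q' = P'].
Proof.
move=> P'p Qp QP'; have [P'id P'1 P'M] := P'p; have [Qid Q1 QM] := Qp.
pose J := [set x | exists y z, [/\ Q y, ideal_ext f P' z & x = y + z]].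
have Jid : is_ideal J by apply: ideal_add => //; apply: ideal_gen_ideal.
have [|||Q' [Q'p JQ' Q'W]] := @exists_prime_avoiding _ J (f @` (~` P')) Jid.
- by exists 1 => //; rewrite rmorph1.
- by move=> _ _ [x Px <-] [y Py <-]; exists (x * y); rewrite ?rmorphM // => /P'M[].
(* Suppose [f s = q + z]. The determinant trick gives [A] over [P'] with
   [\det (z%:M - map_mx f A) = 0]. As [z] is congruent to [f s] modulo [Q], [\det (s%:M - A)]
   contracts into [P']; modulo [P'] it is [s ^+ n], so [s] lies in [P']. *)
- move=> _ [q [z [Qq P'z ->]]] [s P's sE]; apply: P's.
  have [n [A [AP' detA]]] := finite_hom_det P'id P'z.
  apply: (@prime_expr _ _ _ n P'p).
  have sub_det : P' (\det (s%:M - A) - s ^+ n).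
    rewrite -(det_scalar n s); apply: det_cong_ideal => // i j.
    by rewrite !mxE addrAC subrr add0r; apply: idealN.
  have -> : s ^+ n = \det (s%:M - A) - (\det (s%:M - A) - s ^+ n).
    by rewrite opprB addrCA subrr addr0.
  apply: idealB => //; apply: QP'; rewrite /preimage /= -det_map_mx.
  rewrite -[X in Q X]subr0 -detA; apply: det_cong_ideal => // i j.
  rewrite !mxE rmorphB opprB addrA subrK rmorphMn sE -mulrnBl addrK.
  by case: (i == j) => //; case: Qid.
exists Q'; split=> //.
  move=> x Qx; apply: JQ'; exists x, 0; split=> //; last by rewrite addr0.
  by case: (ideal_gen_ideal (f @` P')).
apply/seteqP; split=> x; rewrite /preimage /= => Q'x.
  by apply: contrapT => P'x; apply: Q'W Q'x _; exists x.
apply: JQ'; exists 0, (f x); split; [by case: Qid| |by rewrite add0r].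
exact: sub_ideal_ext.
Qed.

End FiniteExtension.

(** * Integrality and incomparability *)

Section Incomparability.
Variables (R S : comNzRingType) (f : {rmorphism R -> S}).
Hypothesis f_fin : is_finite_hom f.

(** The determinant trick for the unit ideal, whose extension contains every [y]; the monic
    polynomial is the characteristic polynomial of [A]. *)
Lemma finite_hom_integral (y : S) :
  exists2 q : {poly R}, q \is monic & (map_poly f q).[y] = 0.
Proof.
have Tid : is_ideal [set: R] by [].
have [|n [A [_ detA]]] := finite_hom_det f_fin (P := setT) (y := y) Tid.
  rewrite -[y]mulr1; case: (ideal_gen_ideal (f @` setT)) => _ _; apply.
  by apply: sub_ideal_gen; exists 1 => //; rewrite rmorph1.
exists (char_poly A); first exact: char_poly_monic.
rewrite map_char_poly -horner_evalE -det_map_mx -[RHS]detA; congr (\det _).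
apply/matrixP => i j; rewrite !mxE /= horner_evalE.
by rewrite hornerD hornerN hornerMn hornerX hornerC.
Qed.

(** The constant term of a monic relation for [y] lies in [Q'] because [y] does, so it lies in [Q]
    by the hypothesis on contractions. What remains is a multiple of [y]: either [y] is in [Q], or a
    monic relation of lower degree holds modulo [Q]. *)
Lemma incomparability (Q Q' : set S) :
  is_prime Q -> is_ideal Q' -> Q `<=` Q' -> f @^-1` Q' `<=` f @^-1` Q ->
  Q' `<=` Q.
Proof.
move=> [Qid Q1 QM] Q'id QQ' contr y Q'y.
have [q q_monic qy] := finite_hom_integral y.
(* The induction carries membership in [Q] instead of vanishing, since splitting off a factor [y]
   preserves only the former. It stops at the constant 1, which is not in [Q]. *)
have : Q (map_poly f q).[y] by rewrite qy; case: Qid.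
elim/poly_ind: q q_monic {qy} => [|q c IHq].
  by rewrite monicE lead_coef0 eq_sym oner_eq0.
have [->|q_neq0] := eqVneq q 0.
  rewrite mul0r add0r monicE lead_coefC => /eqP ->.
  by rewrite rmorph1 hornerC.
move=> qc_monic; have q_monic : q \is monic.
  move: qc_monic; rewrite !monicE lead_coefDl ?lead_coefMX //.
  rewrite size_mulX // size_polyC.
  by case: (c != 0); rewrite ?ltnS // size_poly_gt0.
rewrite rmorphD rmorphM /= map_polyX map_polyC hornerMXaddC => Qqc.
have Qc : Q (f c).
  apply: contr; rewrite /preimage /=.
  rewrite -[f c](addKr ((map_poly f q).[y] * y)) addrC.
  apply: idealB => //; first exact: QQ'.
  by case: Q'id => _ _; apply.
have /QM[] // : Q ((map_poly f q).[y] * y).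
  by rewrite -[X in Q X](addrK (f c)); apply: idealB.
exact: IHq.
Qed.

End Incomparability.

(** * Dimension and systems of parameters in a finite extension *)

Section Dimension.
Variables (R S : idomainType) (f : {rmorphism R -> S}).
Hypothesis f_inj : injective f.
Hypothesis f_fin : is_finite_hom f.

Lemma is_prime0 (D : idomainType) : is_prime [set 0 : D].
Proof.
split; first split=> //.
- by move=> _ _ -> ->; rewrite /= addr0.
- by move=> c _ ->; rewrite /= mulr0.
- exact/eqP/oner_neq0.
- by move=> x y /eqP; rewrite mulf_eq0 => /orP[] /eqP; [left|right].
Qed.

Lemma lift_prime_chain n (P : nat -> set R) :
  is_prime_chain n P -> exists2 Q : nat -> set S, is_prime_chain n Q &
    forall i, (i <= n)%N -> f @^-1` Q i = P i.
Proof.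
elim: n => [|n IHn] [Pp Plt].
  (* Lying over is going up from the zero prime of [S], which contracts to zero by injectivity. *)
  have [|Q [Qp _ QP]] := going_up f_fin (Pp 0%N (leqnn 0)) (is_prime0 S).
    move=> x /=; rewrite -(rmorph0 f) => /f_inj ->.
    by have [[]] := Pp 0%N (leqnn 0).
  exists (fun=> Q) => [|i]; first by split.
  by rewrite leqn0 => /eqP ->.
have [|Q [Qp Qlt] QP] := IHn.
  by split=> i le_in; [apply/Pp/leqW|apply/Plt/leqW].
have [|Q' [Q'p QQ' Q'P]] := going_up f_fin (Pp n.+1 (leqnn _)) (Qp n (leqnn _)).
  by rewrite QP //; case: (Plt n (ltnSn _)).
pose QQ i := if (i <= n)%N then Q i else Q'.
have QQP i : (i <= n.+1)%N -> f @^-1` QQ i = P i.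
  rewrite /QQ; case: (leqP i n) => [/QP //|lt_ni le_in].
  by have -> : i = n.+1 by apply/eqP; rewrite eqn_leq le_in.
exists QQ => //; split=> i le_in; first by rewrite /QQ; case: leqP => // /Qp.
have QQ_sub : QQ i `<=` QQ i.+1.
  rewrite /QQ -ltnS le_in; case: (ltnP i n) => [/Qlt[] //|le_ni].
  by have -> : i = n by apply/eqP; rewrite eqn_leq le_ni -ltnS le_in.
(* The reverse inclusion would contract to one between [P i.+1] and [P i]. *)
split=> // QQ_sup; have [_] := Plt i le_in; apply.
by rewrite -!QQP // 1?ltnW // => x; apply: QQ_sup.
Qed.

Lemma contract_prime_chain n (Q : nat -> set S) :
  is_prime_chain n Q -> is_prime_chain n (fun i => f @^-1` Q i).
Proof.
move=> [Qp Qlt]; split=> i le_in; first exact/prime_preim/Qp.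
have [QQ nQQ] := Qlt i le_in; split=> [x|contr]; first exact: QQ.
have [Q'id _ _] := Qp i.+1 le_in.
by apply: nQQ; apply: (incomparability f_fin) => //; apply/Qp/ltnW.
Qed.

Lemma krull_dim_finite d : krull_dim R d -> krull_dim S d.
Proof.
move=> [[P /lift_prime_chain[Q Qchain _]] dim_le]; split; first by exists Q.
by move=> n Q' /contract_prime_chain/dim_le.
Qed.

Lemma is_sop_finite d (x : 'I_d -> R) :
  is_local S -> is_local_hom f -> is_sop x -> is_sop (f \o x).
Proof.
move=> Sloc f_loc [dimR [m [mmax radm]]]; split; first exact: krull_dim_finite.
have [n [nmax _]] := Sloc; exists n; split=> //.
have [mid m1 mM] := mmax; have np := maximal_prime nmax; have [nid n1 _] := np.
have contr (Q : set S) : is_prime Q -> m `<=` f @^-1` Q -> f @^-1` Q = m.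
  move=> /(prime_preim f)[Qid Q1 _] mQ.
  by case: (mM _ Qid mQ).
have mn : m `<=` f @^-1` n by move=> r mr; apply: (f_loc m n) => //; exists r.
apply/seteqP; split.
  apply: radical_sub_prime => //; rewrite -ideal_ext_gen.
  apply: ideal_ext_sub => // r Ir; apply: mn.
  by rewrite -radm; exists 1%N; rewrite expr1.
(* Otherwise some prime [Q] containing [IS] misses every power of [y]. Both [Q] and [n] contract to
   [m], and [Q] lies in [n], so incomparability puts [y] in [Q]. *)
move=> y ny; apply: contrapT => nrad.
have [|||Q [Qp IQ QW]] := @exists_prime_avoiding _ (ideal_gen (range (f \o x)))
    [set z | exists k, z = y ^+ k] (ideal_gen_ideal _).
- by exists 0%N.
- by move=> _ _ [k ->] [l ->]; exists (k + l)%N; rewrite exprD.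
- by move=> z Iz [k kE]; apply: nrad; exists k; rewrite -kE.
have [Qid Q1 _] := Qp.
have mQ : m `<=` f @^-1` Q.
  rewrite -radm; apply: radical_sub_prime; first exact: prime_preim.
  by move=> r Ir; apply: IQ; rewrite -ideal_ext_gen; apply: sub_ideal_ext.
apply: (QW y); last by exists 1%N.
apply: (incomparability f_fin Qp nid (local_ideal_sub Sloc nmax Qid Q1) _ ny).
by rewrite (contr n np mn) (contr Q Qp mQ).
Qed.

End Dimension.

(** * The quotient [S/J] as an [R]-module *)

Section QuotientModule.
Variables (R S : comPzRingType) (f : {rmorphism R -> S}).
Variables (J : set S) (Jid : is_ideal J).

(** Carrying the proof that [J] is an ideal lets the subgroup instance be attached to the
    predicate. *)
Definition ideal_pred of is_ideal J : {pred S} := fun x => `[<J x>].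

Lemma ideal_pred_zmod_closed : zmod_closed (ideal_pred Jid).
Proof.
split=> [|x y /asboolP Jx /asboolP Jy]; apply/asboolP; first by case: Jid.
exact: idealB.
Qed.

HB.instance Definition _ :=
  GRing.isZmodClosed.Build S (ideal_pred Jid) ideal_pred_zmod_closed.

(* The unused argument is there to determine the action of R on S / J. *)
Definition quot_module of {rmorphism R -> S} := Quotient.quot (ideal_pred Jid).
Local Notation Q := (quot_module f).

HB.instance Definition _ := GRing.Zmodule.on Q.

Definition quot_proj (s : S) : Q := \pi_(Quotient.quot (ideal_pred Jid))%qT s.
Definition quot_repr (u : Q) : S := repr (u : Quotient.quot (ideal_pred Jid)).

Lemma quot_reprK u : quot_proj (quot_repr u) = u.
Proof. exact: reprK. Qed.

Lemma quot_projP x y : quot_proj x = quot_proj y <-> J (x - y).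
Proof.
split=> [/eqP|Jxy].
  by rewrite /quot_proj -Quotient.idealrBE => /asboolP.
by apply/eqP; rewrite /quot_proj -Quotient.idealrBE; apply/asboolP.
Qed.

Lemma quot_projD x y : quot_proj (x + y) = quot_proj x + quot_proj y.
Proof. by rewrite /quot_proj raddfD. Qed.

Definition quot_scale (r : R) (u : Q) : Q := quot_proj (f r * quot_repr u).

(** Two representatives differ by an element of [J], which absorbs multiplication by [f r]. The
    module axioms then reduce to ring identities in [S]. *)
Lemma quot_scale_proj r s : quot_scale r (quot_proj s) = quot_proj (f r * s).
Proof.
apply/quot_projP; rewrite -mulrBr; have [_ _ JM] := Jid.
by apply: JM; apply/quot_projP; rewrite quot_reprK.
Qed.

Lemma quot_scalerA a b v : quot_scale a (quot_scale b v) = quot_scale (a * b) v.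
Proof. by rewrite -(quot_reprK v) !quot_scale_proj rmorphM mulrA. Qed.

Lemma quot_scale1r : left_id 1 quot_scale.
Proof. by move=> v; rewrite -(quot_reprK v) quot_scale_proj rmorph1 mul1r. Qed.

Lemma quot_scalerDr : right_distributive quot_scale +%R.
Proof.
move=> a u v; rewrite -(quot_reprK u) -(quot_reprK v) -quot_projD.
by rewrite !quot_scale_proj mulrDr quot_projD.
Qed.

Lemma quot_scalerDl v : {morph quot_scale^~ v : a b / a + b}.
Proof.
by move=> a b; rewrite -(quot_reprK v) !quot_scale_proj rmorphD mulrDl quot_projD.
Qed.

HB.instance Definition _ := GRing.Zmodule_isLmodule.Build R Q
  quot_scalerA quot_scale1r quot_scalerDr quot_scalerDl.

Lemma quot_projZ r s : quot_proj (f r * s) = r *: quot_proj s.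
Proof. by rewrite -quot_scale_proj. Qed.

End QuotientModule.

(** * Purity and contraction of extended ideals *)

Section Purity.
Variables (R S : comPzRingType) (f : {rmorphism R -> S}).
Variables (I : set R) (Iid : is_ideal I).

Let Jid : is_ideal (ideal_ext f I) := ideal_gen_ideal _.
Let M : lmodType R := quot_module Iid (idfun : {rmorphism R -> R}).
Let T : lmodType R := quot_module Jid f.
Let pM (r : R) : M := quot_proj idfun Iid r.
Let pT (s : S) : T := quot_proj f Jid s.
Let tau (m : M) (s : S) : T := pT (f (quot_repr m) * s).

Let tau_proj r s : tau (pM r) s = pT (f r * s).
Proof.
apply/quot_projP; rewrite -mulrBl -rmorphB mulrC.
case: (Jid) => _ _; apply; apply: sub_ideal_ext.
by apply/(quot_projP idfun Iid); rewrite quot_reprK.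
Qed.

(** A bilinear [b] on [R/I] and [S] is determined by [b (pM 1)], and this map kills [IS] because
    [f i] can be moved to the left factor, where [i] acts as zero. It therefore factors through
    [S/IS]. *)
Lemma quot_module_tensor : is_tensor_product f tau.
Proof.
have pMK m : exists r, m = pM r by exists (quot_repr m); rewrite /pM quot_reprK.
have pMZ r : pM r = r *: pM 1 by rewrite -quot_projZ mulr1.
split.
  split.
  - move=> m m' s; have [r ->] := pMK m; have [r' ->] := pMK m'.
    by rewrite /pM -quot_projD !tau_proj rmorphD mulrDl /pT quot_projD.
  - by move=> m s s'; rewrite /tau mulrDr /pT quot_projD.
  - move=> r m s; have [r' ->] := pMK m.
    by rewrite /pM -quot_projZ !tau_proj rmorphM -mulrA /pT quot_projZ.
  - by move=> r m s; rewrite /tau mulrCA; apply: quot_projZ.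
move=> N b [bDl bDr bZl bZr].
have b0r m : b m 0 = 0 by apply: (addrI (b m 0)); rewrite -bDr !addr0.
have bN m s : b m (- s) = - b m s.
  by apply/eqP; rewrite -addr_eq0 -bDr addNr b0r.
have b0l s : b 0 s = 0 by rewrite -(scale0r 0) bZl scale0r.
have bJ s : ideal_ext f I s -> b (pM 1) s = 0.
  (* The kernel of [b (pM 1)] is only an [R]-submodule; quantifying over [c] cuts out an ideal of
     [S] inside it. *)
  pose A := [set s | forall c, b (pM 1) (c * s) = 0].
  suff /[apply] /(_ 1) : ideal_ext f I `<=` A by rewrite mul1r.
  apply: ideal_ext_sub => [|i Ii c]; first split.
  - by move=> c; rewrite mulr0.
  - by move=> x y Ax Ay c; rewrite mulrDr bDr Ax Ay addr0.
  - by move=> a x Ax c; rewrite mulrA; apply: Ax.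
  rewrite mulrC bZr -bZl -pMZ.
  suff -> : pM i = 0 by [].
  rewrite -(scale0r (pM 1)) -pMZ; apply/quot_projP.
  by rewrite subr0.
pose g (u : T) : N := b (pM 1) (quot_repr u).
have g_proj s : g (pT s) = b (pM 1) s.
  apply/eqP; rewrite -subr_eq0 -bN -bDr; apply/eqP/bJ.
  by apply/(quot_projP f Jid); rewrite quot_reprK.
have g_lin : linear g.
  move=> c u v; rewrite -(quot_reprK u) -(quot_reprK v).
  by rewrite -quot_projZ -quot_projD !g_proj bDr bZr.
pose gL : {linear T -> N} := HB.pack g (GRing.isLinear.Build _ _ _ _ g g_lin).
exists gL; split=> [m s|g' g'E u].
  by have [r ->] := pMK m; rewrite tau_proj /= g_proj bZr -bZl -pMZ.
rewrite -(quot_reprK u) /= -[quot_proj _ _ _]/(pT _) g_proj -g'E tau_proj.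
by rewrite rmorph1 mul1r.
Qed.

Lemma pure_contract_ideal x : is_pure f -> ideal_ext f I (f x) -> I x.
Proof.
move=> /(_ M T tau quot_module_tensor) tau_inj Jx.
have : pM x = pM 0.
  apply: tau_inj; rewrite !tau_proj; apply/quot_projP.
  by rewrite rmorph0 mul0r subr0 mulr1.
by move=> /quot_projP; rewrite subr0.
Qed.

End Purity.

(** * Frobenius powers, ordinary powers and tight closure under extension *)

Lemma frobenius_pow_ext (R S : comPzRingType) (f : {rmorphism R -> S})
    (I : set R) q x :
  frobenius_pow I q x -> frobenius_pow (ideal_ext f I) q (f x).
Proof.
move: x; apply: (ideal_gen_sub (ideal_preim f (ideal_gen_ideal _))).
move=> _ [u Iu <-]; rewrite /preimage /= rmorphXn.
by apply: sub_ideal_gen; exists (f u) => //; apply: sub_ideal_ext.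
Qed.

Lemma ideal_powS (R : comPzRingType) (a : set R) n x y :
  ideal_pow a n x -> a y -> ideal_pow a n.+1 (x * y).
Proof.
move=> ax ay; move: x ax.
have [J0 JD JM] := ideal_gen_ideal [set x | exists u : 'I_n.+1 -> R,
  (forall i, a (u i)) /\ x = \prod_(i < n.+1) u i].
apply: ideal_gen_sub; first split.
- by rewrite mul0r.
- by move=> x x' Jx Jx'; rewrite mulrDl; apply: JD.
- by move=> c x Jx; rewrite -mulrA; apply: JM.
move=> _ [u [au ->]]; apply: sub_ideal_gen.
(* The factor [y] is appended at the last index. *)
exists (fun i => if unlift ord_max i is Some j then u j else y); split.
  by move=> i; case: unliftP.
rewrite big_ord_recr /= unlift_none; congr (_ * _).
apply: eq_bigr => i _.
have -> : widen_ord (leqnSn n) i = lift ord_max i.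
  exact/val_inj/esym/lift_max.
by rewrite liftK.
Qed.

Lemma ideal_pow_ext_sub (R S : comPzRingType) (f : {rmorphism R -> S})
    (a : set R) n :
  ideal_pow (ideal_ext f a) n `<=` ideal_ext f (ideal_pow a n).
Proof.
apply: ideal_gen_sub => [|_ [u [au ->]]]; first exact: ideal_gen_ideal.
elim: n u au => [|n IHn] u au.
  rewrite big_ord0 -(rmorph1 f); apply: sub_ideal_ext.
  by apply: sub_ideal_gen; exists (fun=> 0); split; [case|rewrite big_ord0].
rewrite big_ord_recr /=; set y := u ord_max.
have : ideal_ext f (ideal_pow a n) (\prod_(i < n) u (widen_ord (leqnSn n) i)).
  exact: IHn.
have [J0 JD JM] := ideal_gen_ideal (f @` ideal_pow a n.+1).
(* With the first [n] factors and the last one generalized, linearity in each reduces the claim to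
   images of elements of [ideal_pow a n] and of [a]. *)
move: (\prod_(i < n) _) => z; move: z y (au ord_max : ideal_ext f a y).
suff sub_y y : ideal_ext f a y -> ideal_ext f (ideal_pow a n) `<=`
    [set z | ideal_ext f (ideal_pow a n.+1) (z * y)].
  by move=> z y /sub_y; apply.
move=> ay; apply: ideal_ext_sub; first split.
- by rewrite /= mul0r.
- by move=> z z' Jz Jz'; rewrite /= mulrDl; apply: JD.
- by move=> c z Jz; rewrite /= -mulrA; apply: JM.
move=> r ar; move: y ay; apply: ideal_ext_sub; first split.
- by rewrite /= mulr0.
- by move=> z z' Jz Jz'; rewrite /= mulrDr; apply: JD.
- by move=> c z Jz; rewrite /= mulrCA; apply: JM.
move=> s as_; rewrite /= -rmorphM; apply: sub_ideal_ext.
exact: ideal_powS.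
Qed.

(** Zero is the only minimal prime of a domain. *)
Lemma ring_circ_idomain (D : idomainType) (c : D) :
  ring_circ c <-> c != 0.
Proof.
split=> [circ|c0 P [Pp Pmin] Pc].
  apply/eqP => c0; apply: (circ [set 0]) => //; split; first exact: is_prime0.
  move=> Q [[Q0 _ _] _ _] Q_sub; apply/seteqP; split=> // _ ->.
  exact: Q0.
have P_eq : [set 0] = P.
  by apply: Pmin; [exact: is_prime0|move=> _ ->; case: Pp => [[]]].
by move/eqP: c0; apply; rewrite -P_eq in Pc.
Qed.

Lemma sub_tight_closure (p : nat) (D : idomainType) (K : realType)
    (I a : set D) (t : K) :
  I `<=` tight_closure p I a t.
Proof.
move=> z Iz; exists 1; split; first by apply/ring_circ_idomain; exact: oner_neq0.
exists 0%N => e _ x _; have [_ _ JM] := ideal_gen_ideal [set x ^+ (p ^ e) | x in I].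
by apply: JM; apply: sub_ideal_gen; exists z.
Qed.

Lemma tight_closure_ext (p : nat) (R S : idomainType) (f : {rmorphism R -> S})
    (K : realType) (I a : set R) (t : K) z :
  injective f -> tight_closure p I a t z ->
  tight_closure p (ideal_ext f I) (ideal_ext f a) t (f z).
Proof.
move=> f_inj [c [/ring_circ_idomain c0 [e0 ce]]]; exists (f c); split.
  by apply/ring_circ_idomain; rewrite -(rmorph0 f) (inj_eq f_inj).
exists e0 => e le_e x /ideal_pow_ext_sub ax.
have [J0 JD JM] := ideal_gen_ideal [set x ^+ (p ^ e) | x in ideal_ext f I].
(* The condition on [x] is [S]-linear and [x] lies in the extension of a power of [a], so it
   suffices to test images of elements of that power. *)
move: x ax; apply: ideal_ext_sub; first split.
- by rewrite /= mulr0 mul0r.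
- by move=> x y Jx Jy; rewrite /= mulrDr mulrDl; apply: JD.
- by move=> b x Jx; rewrite /= mulrCA -mulrA; apply: JM.
move=> x ax; rewrite /= -rmorphXn -!rmorphM.
by apply: frobenius_pow_ext; apply: ce.
Qed.

Theorem proposition7p1 (p : nat) (R S : idomainType) (f : {rmorphism R -> S})
    (a : set R) (K : realType) (t : K)
    (charR : p \in [pchar R]) (charS : p \in [pchar S])
    (excR : excellent R) (excS : excellent S)
    (locR : is_local R) (locS : is_local S)
    (f_inj : injective f) (f_loc : is_local_hom f)
    (f_fin : is_finite_hom f) (f_pure : is_pure f)
    (a_ideal : is_ideal a) (a_neq0 : exists2 x, a x & x != 0)
    (t_ge0 : 0 <= t) :
  F_rational p (ideal_ext f a) t -> F_rational p a t.
Proof.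
move=> S_rat d x x_sop; apply/seteqP; split; last exact: sub_tight_closure.
move=> z /(tight_closure_ext f_inj); rewrite ideal_ext_gen S_rat; last first.
  exact: is_sop_finite.
rewrite -ideal_ext_gen; apply: pure_contract_ideal f_pure.
exact: ideal_gen_ideal.
Qed.
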